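(* Let $\mathbb P,\mathbb Q\in\mathcal P(\mathbb R^n)$, $\varepsilon_1,\varepsilon_2\ge0$, and let $c:\mathbb R^n\to\mathbb R_{\ge0}$ be a translation-invariant transportation cost (the cost of moving $x_1$ to $x_2$ being $c(x_1-x_2)$) such that (i) $c(x_1\cdot x_3-x_2\cdot x_3)\le c(x_1-x_2)\,c(x_3)$ for all $x_1,x_2,x_3\in\mathbb R^n$; (ii) there is $p\ge1$ such that $c^{1/p}(x_1-x_3)\le c^{1/p}(x_1-x_2)+c^{1/p}(x_2-x_3)$ for all $x_1,x_2,x_3\in\mathbb R^n$. Then $$\mathbb B_{\varepsilon_1}^c(\mathbb P)\odot\mathbb B_{\varepsilon_2}^c(\mathbb Q)\subset\mathbb B^c_{\rho}(\mathbb P\odot\mathbb Q),\qquad \rho=\Big(\varepsilon_1^{1/p}\varepsilon_2^{1/p}+\varepsilon_1^{1/p}\,\mathbb E_{\mathbb Q}[c(x)]^{1/p}+\varepsilon_2^{1/p}\,\mathbb E_{\mathbb P}[c(x)]^{1/p}\Big)^p.$$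
   Context: $x\cdot y$ denotes the element-wise (Hadamard) product on $\mathbb R^n$. $\mathcal P(\mathbb R^n)$ is the set of Borel probability distributions on $\mathbb R^n$. The Hadamard product $\mathbb P\odot\mathbb Q$ is the distribution of $x\cdot y$ for independent $x\sim\mathbb P$, $y\sim\mathbb Q$; for sets, $S_1\odot S_2=\{\mathbb P'\odot\mathbb Q':\mathbb P'\in S_1,\mathbb Q'\in S_2\}$. $\mathbb E_{\mathbb Q}[c(x)]=\int c\,d\mathbb Q$ (possibly $+\infty$, with $0\cdot\infty=0$). Transportation costs are non-negative and lower semi-continuous. $W_c(\mathbb P,\mathbb Q)=\inf_{\gamma\in\Gamma(\mathbb P,\mathbb Q)}\int c(x_1-x_2)\,d\gamma(x_1,x_2)$, where $\Gamma(\mathbb P,\mathbb Q)$ is the set of couplings of $\mathbb P$ and $\mathbb Q$, and $\mathbb B_\varepsilon^c(\mathbb P)=\{\mathbb Q\in\mathcal P(\mathbb R^n):W_c(\mathbb P,\mathbb Q)\le\varepsilon\}$.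
   Formalization: In W_c(P,Q) the couplings are taken with x_1 ~ Q and x_2 ~ P; with the usual order the claim fails for uneven c (n=1, p=1, c(x)=max(x,-2x), P=Q=δ_0, ε_1=ε_2=1, δ_{-1} in both balls). For even c the two orders agree. *)

(* Defs.v *)
From HB Require Import structures.
From mathcomp Require Import all_boot all_order all_algebra.
From mathcomp Require Import all_classical all_reals all_analysis measurable_realfun.

Set Implicit Arguments.
Unset Strict Implicit.
Unset Printing Implicit Defensive.

Import Order.TTheory GRing.Theory Num.Theory.
Import numFieldNormedType.Exports.

Local Open Scope classical_set_scope.
Local Open Scope ring_scope.

(** R^n, as row vectors with their Borel sigma-algebra. *)
Notation borel_rV R n := (g_sigma_algebraType (@open 'rV[R]_n)).

Definition hadamard (R : realType) (n : nat) (x y : 'rV[R]_n) : 'rV[R]_n :=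
  map2_mx *%R x y.

Definition hadamard_pair (R : realType) (n : nat)
    (z : borel_rV R n * borel_rV R n) : borel_rV R n :=
  hadamard z.1 z.2.

Section hadamard_measurable.
Context {R : realType} {n : nat}.

Lemma measurable_coord (i : 'I_n) :
  measurable_fun [set: borel_rV R n] (fun x : borel_rV R n => (x : 'rV[R]_n) 0 i).
Proof.
apply: (measurability _ (RGenOpens.measurableE R)) => _ [_ [a [b ->]] <-].
rewrite setTI; apply: sub_sigma_algebra.
move/continuousP: (@coord_continuous R 1 n 0 i); apply.
exact: interval_open.
Qed.

Lemma measurable_to_rV d (T : measurableType d) (f : T -> borel_rV R n) :
  (forall i, measurable_fun [set: T] (fun x => (f x : 'rV[R]_n) 0 i)) ->
  measurable_fun [set: T] f.
Proof.
move=> mf; apply: (@measurability _ _ T (borel_rV R n) setT f (@open 'rV[R]_n)) => // _ [U oU <-].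
rewrite setTI.
pose box (q : 'rV[rat]_n * 'rV[rat]_n) : set 'rV[R]_n :=
  [set x | forall i, ratr (q.1 0 i) < x 0 i < ratr (q.2 0 i)].
have -> : f @^-1` U =
    \bigcup_(q in [set q | box q `<=` U]) (f @^-1` box q).
  apply/seteqP; split=> [t Ut|t [q /= qU]]; last exact: qU.
  have [e /= e0 eU] : exists2 e : R, 0 < e & ball (f t : 'rV[R]_n) e `<=` U.
    by apply/nbhs_ballP; exact: open_nbhs_nbhs.
  pose x : 'rV[R]_n := f t.
  have hl (i : 'I_n) : {a : rat | x 0 i - e < ratr a < x 0 i}.
    apply/cid; have /rat_in_itvoo[a] : x 0 i - e < x 0 i by rewrite ltrBlDr ltrDl.
    by rewrite in_itv/=; exists a.
  have hr (i : 'I_n) : {a : rat | x 0 i < ratr a < x 0 i + e}.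
    apply/cid; have /rat_in_itvoo[a] : x 0 i < x 0 i + e by rewrite ltrDl.
    by rewrite in_itv/=; exists a.
  exists (\row_i sval (hl i), \row_i sval (hr i)) => /=.
    move=> y yq; apply: eU; split=> // j i; rewrite (ord1 j) /ball/=.
    have := yq i; rewrite !mxE/=.
    case: (hl i) => a /= /andP[a1 a2]; case: (hr i) => b /= /andP[b1 b2].
    move=> /andP[ay yb]; rewrite distrC ltr_distl.
    by rewrite (lt_trans a1 ay) (lt_trans yb b2).
  move=> i; rewrite !mxE/=.
  by case: (hl i) => a /= /andP[_ ->]; case: (hr i) => b /= /andP[-> _].
rewrite bigcup_mkcond.
apply: countable_bigcupT_measurable => [|q]; first exact: countableP.
case: ifPn => // _.
have -> : f @^-1` box q =
    \bigcap_(i in [set: 'I_n]) (fun x => (f x : 'rV[R]_n) 0 i) @^-1`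
      `]ratr (q.1 0 i), ratr (q.2 0 i)[%classic.
  apply/seteqP; split=> t /= h i; first by move=> _ /=; rewrite in_itv/=; exact: h.
  by have := h i I; rewrite /= in_itv.
apply: fin_bigcap_measurable => // i _; rewrite -[X in measurable X]setTI.
exact: mf.
Qed.

Lemma measurable_hadamard_pair : measurable_fun setT (@hadamard_pair R n).
Proof.
apply: measurable_to_rV => i; rewrite /hadamard_pair; under eq_fun do rewrite mxE.
by apply: measurable_funM; apply: (measurableT_comp (measurable_coord i)).
Qed.

HB.instance Definition _ := isMeasurableFun.Build _ _ _ _
  (@hadamard_pair R n) measurable_hadamard_pair.

End hadamard_measurable.

Section optimal_transport.
Context {R : realType} {n : nat}.
Implicit Types (P Q : probability (borel_rV R n) R) (c : 'rV[R]_n -> R).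

Definition hadamard_prob P Q : probability (borel_rV R n) R :=
  distribution (P \x Q)%E (@hadamard_pair R n).

Definition hadamard_set (S1 S2 : set (probability (borel_rV R n) R)) :
    set (probability (borel_rV R n) R) :=
  [set hadamard_prob P Q | P in S1 & Q in S2].

(** Order of the marginals: in [coupling P Q], [x1 ~ Q] and [x2 ~ P], so that
    [c (x1 - x2)] is the cost of the displacement from [x2 ~ P] to [x1 ~ Q].
    The order is immaterial when [c] is even.  For uneven [c] it matters: with
    [x1 ~ P] and [x2 ~ Q], balls need not propagate through Hadamard products.
    For n = 1, p = 1, c x = max(x, -2x), the Dirac measure at -1 would be in
    the unit ball around the Dirac measure at 0, but its Hadamard square, the
    Dirac measure at 1, would be at cost 2 from the latter. *)
Definition coupling P Q
    : set (probability (borel_rV R n * borel_rV R n)%type R) :=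
  [set g | forall A : set (borel_rV R n), measurable A ->
     g (snd @^-1` A) = P A /\ g (fst @^-1` A) = Q A].

Definition transport_cost c P Q : \bar R :=
  ereal_inf [set (\int[g]_z (c ((z.1 : 'rV[R]_n) - (z.2 : 'rV[R]_n)))%:E)%E
            | g in coupling P Q].

Definition transport_ball c (r : \bar R) P :
    set (probability (borel_rV R n) R) :=
  [set Q | (transport_cost c P Q <= r)%E].

End optimal_transport.

(* Main.v *)
Require Import Defs.
From HB Require Import structures.
From mathcomp Require Import all_boot all_order all_algebra.
From mathcomp Require Import all_classical all_reals all_analysis measurable_realfun.

Set Implicit Arguments.
Unset Strict Implicit.
Unset Printing Implicit Defensive.

Import Order.TTheory GRing.Theory Num.Theory.
Import numFieldNormedType.Exports.

Local Open Scope classical_set_scope.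
Local Open Scope ring_scope.

(** Let P' and Q' lie in the balls of radii e1 and e2 around P and Q.  If
    (x', x) and (y', y) are couplings of P' with P and of Q' with Q, then
    (x' y', x y) is a candidate coupling of the Hadamard products.  Going from
    x y to x' y' through x' y, the triangle inequality for c^(1/p) and the
    submultiplicativity of c give ([root_cost_hadamard])

      c (x' y' - x y)^(1/p) <=
        (c (x' - x) c y)^(1/p) + (c x' c (y' - y))^(1/p).

    If the two couplings were optimal and independent of each other,
    Minkowski's inequality ([le_root_integral_add]) would bound the p-th root
    of the cost by (e1 E_Q[c])^(1/p) + (e2 E_P'[c])^(1/p), and
    E_P'[c]^(1/p) <= e1^(1/p) + E_P[c]^(1/p) ([root_moment_ball]) would finish
    the proof.

    Couplings of cost exactly e1 and e2 are not at hand, since the transport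
    cost is an infimum, and an independent pair of couplings of costs e1 + d
    and e2 + d is not good enough: when e1 = 0 and E_Q[c] is infinite, the
    product e1 E_Q[c] is 0 while (e1 + d) E_Q[c] is infinite for every d > 0.
    Instead of producing optimal couplings by compactness, the precision of one
    coupling is made to depend on the variable of the other factor that its
    cost is multiplied by.  Cut the space into the levels
    L_k = {k <= c < k + 1}, take couplings g1_l and g2_l of excess cost at most
    eta / (2^(l+1) (l+1)), and let the quadruple ((x', x), (y', y)) have the law

      sum over k and l of (g1_l \x g2_k) restricted to x' in L_k, y in L_l.

    This is [crossed_mixture]: y selects the coupling of x' with x, and x'
    selects the coupling of y' with y.  Only x' and y are used to select, and
    their laws P' and Q do not depend on which coupling is selected.  For this
    reason one of the two sums collapses whenever the integrand involves only x'
    from the first pair, or only y from the second.  Hence x' and y' are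
    independent with laws P' and Q', x and y are independent with laws P and Q
    ([crossed_mixture_marginal_right], [crossed_mixture_marginal_left]), and the
    expectations of c (x' - x) c y and of c x' c (y' - y) exceed e1 E_Q[c] and
    e2 E_P'[c] by at most eta ([crossed_mixture_cost_left],
    [crossed_mixture_cost_right]), also when these moments are infinite.  It
    remains to let eta tend to 0. *)

(** * Measurability *)

Lemma measurable_lsc (R : realType) (n : nat) (c : 'rV[R]_n -> R) :
  lower_semicontinuous (fun x => (c x)%:E) ->
  measurable_fun [set: borel_rV R n] c.
Proof.
move=> lscc; apply: (measurability _ (RGenOInfty.measurableE R)).
move=> _ [_ [a ->] <-]; rewrite setTI preimage_itvoy.
apply: sub_sigma_algebra.
by move/lower_semicontinuousP : lscc => /(_ a); under eq_set do rewrite lte_fin.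
Qed.

(** R^n x R^n carries the product of the Borel sigma-algebras rather than the
    sigma-algebra of its open sets, so measurability is read off the coordinates
    and not deduced from continuity. *)
Lemma measurable_sub_rV (R : realType) (n : nat) :
  measurable_fun [set: borel_rV R n * borel_rV R n]
    (fun z : borel_rV R n * borel_rV R n =>
       (z.1 : 'rV[R]_n) - (z.2 : 'rV[R]_n) : borel_rV R n).
Proof.
apply: measurable_to_rV => i; under eq_fun do rewrite !mxE.
by apply: measurable_funB; apply: (measurableT_comp (measurable_coord i)).
Qed.

(** * Inequalities for p-th roots *)

(** With s = u^p this says u^p + t^p <= (u + t)^p, which follows by bounding
    u^(p-1) and t^(p-1) by (u + t)^(p-1). *)
Lemma powR_subadditive (R : realType) (p s t : R) : 1 <= p -> 0 <= s -> 0 <= t ->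
  (s + t `^ p) `^ p^-1 <= s `^ p^-1 + t.
Proof.
move=> p1 s0 t0.
have p0 : 0 < p by rewrite (lt_le_trans _ p1).
set u := s `^ p^-1.
have u0 : 0 <= u := powR_ge0 _ _.
have -> : s = u `^ p by rewrite /u -powRrM mulVf ?gt_eqF// powRr1.
have ut0 : 0 <= u + t by rewrite addr_ge0.
rewrite -[leRHS]powRr1// -[X in _ <= _ `^ X](mulfV (lt0r_neq0 p0)) powRrM.
have e0 : 0 <= p^-1 by rewrite invr_ge0 ltW.
rewrite ge0_ler_powR ?nnegrE ?addr_ge0 ?powR_ge0//.
have powRS (x : R) : 0 <= x -> x `^ p = x * x `^ (p - 1).
  move=> x0; have [->|xN0] := eqVneq x 0; first by rewrite powR0 ?mul0r// gt_eqF.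
  rewrite -{1}(subrKC 1 p) [LHS]powRD; first by rewrite powRr1.
  by rewrite xN0 implybT.
rewrite !powRS// mulrDl.
by rewrite lerD// ler_wpM2l// ge0_ler_powR ?nnegrE ?subr_ge0 ?lerDl ?lerDr.
Qed.

Local Open Scope ereal_scope.

(** An additive error [a `^ p] under the p-th root costs at most [a] outside,
    even when [y] is infinite: this is how the error terms are sent to 0. *)
Lemma root_le_add (R : realType) (p a : R) (x y : \bar R) : (1 <= p)%R ->
  0 <= x -> 0 <= y -> (0 <= a)%R -> x <= y + (a `^ p)%:E ->
  x `^ p^-1 <= y `^ p^-1 + a%:E.
Proof.
move=> p1 x0 y0 a0 xy.
have p0 : (0 < p)%R by rewrite (lt_le_trans _ p1).
have e0 : (0 <= p^-1)%R by rewrite invr_ge0 ltW.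
apply: (@le_trans _ _ ((y + (a `^ p)%:E) `^ p^-1)).
  apply: gt0_ler_poweR => //; rewrite in_itv/= leey andbT//.
  by rewrite adde_ge0// lee_fin powR_ge0.
case: y y0 {xy} => [y y0| _|//].
  by rewrite lee_fin powR_subadditive.
by rewrite addye// poweRyr ?addye ?leey// gt_eqF// invr_gt0.
Qed.

(** Minkowski's inequality for the functions v^(1/p) and w^(1/p), whose L^p norms
    are the p-th roots of the integrals of v and w. *)
Lemma le_root_integral_add d (T : measurableType d) (R : realType)
    (mu : {measure set T -> \bar R}) (p : R) (u v w : T -> R) :
  (1 <= p)%R -> measurable_fun [set: T] u -> measurable_fun [set: T] v ->
  measurable_fun [set: T] w -> (forall x, (0 <= u x)%R) ->
  (forall x, (0 <= v x)%R) -> (forall x, (0 <= w x)%R) ->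
  (forall x, u x `^ p^-1 <= v x `^ p^-1 + w x `^ p^-1)%R ->
  (\int[mu]_x (u x)%:E) `^ p^-1
    <= (\int[mu]_x (v x)%:E) `^ p^-1 + (\int[mu]_x (w x)%:E) `^ p^-1.
Proof.
move=> p1 mfu mv mw u0 v0 w0 uvw.
have p0 : (0 < p)%R by rewrite (lt_le_trans _ p1).
have e0 : (0 <= p^-1)%R by rewrite invr_ge0 ltW.
have LnormE (f : T -> R) : (forall x, (0 <= f x)%R) ->
    Lnorm mu p%:E (EFin \o (fun x => (f x `^ p^-1)%R)) =
    (\int[mu]_x (f x)%:E) `^ p^-1.
  move=> f0; rewrite unlock; congr (_ `^ _); apply: eq_integral => x _ /=.
  by rewrite ger0_norm ?powR_ge0// -powRrM mulVf ?gt_eqF// powRr1.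
have mpow (f : T -> R) : measurable_fun [set: T] f ->
    measurable_fun [set: T] (fun x => (f x `^ p^-1)%R).
  by move=> mf; apply: (measurableT_comp (measurable_powR p^-1) mf).
rewrite -(LnormE v)// -(LnormE w)//.
apply: le_trans (minkowski_EFin mu (mpow _ mv) (mpow _ mw) p1).
rewrite unlock; apply: gt0_ler_poweR => //.
- by rewrite in_itv/= leey andbT integral_ge0// => x _; rewrite lee_fin.
- by rewrite in_itv/= leey andbT integral_ge0// => x _; exact: poweR_ge0.
apply: ge0_le_integral => //.
- by move=> x _; rewrite lee_fin.
- exact/measurable_EFinP.
- apply/measurable_EFinP.
  apply: (measurableT_comp (measurable_powR p)).
  by apply: measurableT_comp => //; apply: measurable_funD; exact: mpow.
- move=> x _; rewrite lee_fin ger0_norm ?addr_ge0 ?powR_ge0//.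
  rewrite -[leLHS]powRr1// -[X in (_ `^ X <= _)%R](mulVf (lt0r_neq0 p0)) powRrM.
  by rewrite ge0_ler_powR ?nnegrE ?addr_ge0 ?powR_ge0// ltW.
Qed.

(** * Integrals against restrictions, products and marginals *)

(** The complement of [D] is negligible for the restriction, and the two measures
    agree on the subsets of [D]. *)
Lemma ge0_integral_mrestr d (T : measurableType d) (R : realType)
    (mu : {measure set T -> \bar R}) (D : set T) (mD : measurable D)
    (f : T -> \bar R) :
  measurable_fun [set: T] f -> (forall x, 0 <= f x) ->
  \int[mrestr mu mD]_x f x = \int[mu]_(x in D) f x.
Proof.
move=> mf f0.
rewrite (@ge0_negligible_integral _ _ _ _ setT (~` D))//; last 2 first.
- exact: measurableC.
- by apply: etrans (measure0 mu); rewrite /= /mrestr setICl.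
rewrite setTD setCK; apply: eq_measure_integral => A mA AD.
by rewrite /= /mrestr setIidl.
Qed.

Lemma ge0_integral_prod d1 d2 (T1 : measurableType d1) (T2 : measurableType d2)
    (R : realType) (m1 : probability T1 R) (m2 : probability T2 R)
    (f : T1 -> \bar R) (h : T2 -> \bar R) :
  measurable_fun [set: T1] f -> measurable_fun [set: T2] h ->
  (forall x, 0 <= f x) -> (forall y, 0 <= h y) ->
  \int[m1 \x m2]_z (f z.1 * h z.2) = \int[m1]_x f x * \int[m2]_y h y.
Proof.
move=> mf mh f0 h0.
rewrite fubini_tonelli1/=; last 2 first.
- by apply: emeasurable_funM; apply: measurableT_comp.
- by move=> z; rewrite mule_ge0.
rewrite -ge0_integralZr//; last exact: integral_ge0.
by apply: eq_integral => x _; rewrite /fubini_F/= ge0_integralZl.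
Qed.

Lemma ge0_integral_partition d (T : measurableType d) (R : realType)
    (mu : {measure set T -> \bar R}) (A : nat -> set T) (f : T -> \bar R) :
  (forall k, measurable (A k)) -> trivIset [set: nat] A ->
  \bigcup_k A k = [set: T] -> measurable_fun [set: T] f -> (forall x, 0 <= f x) ->
  \sum_(k <oo) \int[mu]_(x in A k) f x = \int[mu]_x f x.
Proof. by move=> mA tA UA mf f0; rewrite -ge0_integral_bigcup ?UA. Qed.

Lemma ge0_integral_marginal d d' (T : measurableType d) (T' : measurableType d')
    (R : realType) (g : {measure set T -> \bar R}) (m : {measure set T' -> \bar R})
    (phi : T -> T') (D : set T') (f : T' -> \bar R) :
  measurable_fun [set: T] phi ->
  (forall S, measurable S -> g (phi @^-1` S) = m S) ->
  measurable D -> measurable_fun [set: T'] f -> (forall y, 0 <= f y) ->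
  \int[g]_(x in phi @^-1` D) f (phi x) = \int[m]_(y in D) f y.
Proof.
move=> mphi gm mD mf f0.
rewrite -[LHS](ge0_integral_pushforward mphi)//; last exact: measurable_funTS.
by apply: eq_measure_integral => S mS _; exact: gm.
Qed.

Lemma probability_of_mass_one d (T : measurableType d) (R : realType)
    (m : {measure set T -> \bar R}) :
  m [set: T] = 1 -> exists P : probability T R, P = m :> (set T -> \bar R).
Proof.
move=> m1; exists (mnormalize m (dirac point)).
by apply/funext => S; rewrite /= /mnormalize m1 onee_eq0/= invr1 mule1.
Qed.

(** * Crossed mixtures of two sequences of probability measures *)

Section crossed_mixture.
Context d1 d2 (T1 : measurableType d1) (T2 : measurableType d2) (R : realType).
Variables (g1 : nat -> probability T1 R) (g2 : nat -> probability T2 R).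
Variables (A : nat -> set T1) (B : nat -> set T2).
Hypotheses (mA : forall k, measurable (A k)) (mB : forall l, measurable (B l)).
Hypotheses (tA : trivIset [set: nat] A) (tB : trivIset [set: nat] B).
Hypotheses (UA : \bigcup_k A k = [set: T1]) (UB : \bigcup_l B l = [set: T2]).

(** The indices are crossed: the cell [B l] of the second factor selects the
    measure [g1 l] on the first one, and the cell [A k] of the first factor
    selects the measure [g2 k] on the second one.  Each measure is selected by the
    factor on which it does not live. *)
Definition crossed_mixture : {measure set (T1 * T2) -> \bar R} :=
  mseries (fun k => mseries (fun l =>
    mrestr (g1 l \x g2 k) (measurableX (mA k) (mB l))) 0) 0.

Lemma integral_crossed_mixture (f : T1 -> \bar R) (h : T2 -> \bar R) :
  measurable_fun [set: T1] f -> measurable_fun [set: T2] h ->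
  (forall x, 0 <= f x) -> (forall y, 0 <= h y) ->
  \int[crossed_mixture]_z (f z.1 * h z.2) =
  \sum_(k <oo) \sum_(l <oo)
    (\int[g1 l]_(x in A k) f x * \int[g2 k]_(y in B l) h y).
Proof.
move=> mf mh f0 h0.
have mfh : measurable_fun [set: T1 * T2] (fun z => f z.1 * h z.2).
  by apply: emeasurable_funM; apply: measurableT_comp.
have fh0 z : 0 <= f z.1 * h z.2 by rewrite mule_ge0.
rewrite ge0_integral_measure_series//; apply: eq_eseriesr => k _.
rewrite ge0_integral_measure_series//; apply: eq_eseriesr => l _.
rewrite ge0_integral_mrestr// integral_mkcond.
rewrite (integral_mkcond (A k)) (integral_mkcond (B l)) -ge0_integral_prod.
- apply: eq_integral => z _; rewrite /patch in_setX.
  by case: (_ \in _); case: (_ \in _); rewrite ?mul0e ?mule0.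
- by apply: (measurable_restrictT _ (mA _)).1; exact: measurable_funTS.
- by apply: (measurable_restrictT _ (mB _)).1; exact: measurable_funTS.
- by move=> x; apply: erestrict_ge0.
- by move=> x; apply: erestrict_ge0.
Qed.

(** If the integrals of [h] over the cells of the second factor do not depend on
    the measure selected there, the sum over the cells of the first factor
    collapses to an integral over the whole factor. *)
Lemma integral_crossed_mixture_left (f : T1 -> \bar R) (h : T2 -> \bar R)
    (b : nat -> \bar R) :
  measurable_fun [set: T1] f -> measurable_fun [set: T2] h ->
  (forall x, 0 <= f x) -> (forall y, 0 <= h y) ->
  (forall k l, \int[g2 k]_(y in B l) h y = b l) ->
  \int[crossed_mixture]_z (f z.1 * h z.2) =
  \sum_(l <oo) (\int[g1 l]_x f x * b l).
Proof.
move=> mf mh f0 h0 hb; have b0 l : 0 <= b l by rewrite -(hb 0%N) integral_ge0.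
rewrite integral_crossed_mixture// nneseries_interchange; last first.
  by move=> k l; rewrite mule_ge0 ?integral_ge0.
apply: eq_eseriesr => l _; rewrite -ge0_integralZr//.
rewrite -(ge0_integral_partition _ mA tA UA); last 2 first.
- by apply: emeasurable_funM.
- by move=> x; rewrite mule_ge0.
apply: eq_eseriesr => k _; rewrite hb ge0_integralZr//.
exact: measurable_funTS mf.
Qed.

Lemma integral_crossed_mixture_right (f : T1 -> \bar R) (h : T2 -> \bar R)
    (a : nat -> \bar R) :
  measurable_fun [set: T1] f -> measurable_fun [set: T2] h ->
  (forall x, 0 <= f x) -> (forall y, 0 <= h y) ->
  (forall k l, \int[g1 l]_(x in A k) f x = a k) ->
  \int[crossed_mixture]_z (f z.1 * h z.2) =
  \sum_(k <oo) (a k * \int[g2 k]_y h y).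
Proof.
move=> mf mh f0 h0 fa; have a0 k : 0 <= a k by rewrite -(fa k 0%N) integral_ge0.
rewrite integral_crossed_mixture//.
apply: eq_eseriesr => k _; rewrite -ge0_integralZl//.
rewrite -(ge0_integral_partition _ mB tB UB); last 2 first.
- by apply: emeasurable_funM.
- by move=> x; rewrite mule_ge0.
apply: eq_eseriesr => l _; rewrite fa ge0_integralZl//.
exact: measurable_funTS mh.
Qed.

End crossed_mixture.

(** The excess eta / (2^(k+1) (k+1)) absorbs a weight that is at most k + 1 and
    leaves a geometric series of sum eta.  The total weight itself is allowed to be
    infinite; if moreover e = 0 the bound is still eta. *)
Lemma series_near_optimal_le (R : realType) (a w : nat -> \bar R) (e eta : R) :
  (0 <= e)%R -> (0 <= eta)%R -> (forall k, 0 <= a k <= k.+1%:R%:E) ->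
  (forall k, 0 <= w k) ->
  (forall k, w k <= (e + eta / (2 ^ k.+1)%:R / k.+1%:R)%:E) ->
  \sum_(k <oo) (a k * w k) <= e%:E * \sum_(k <oo) a k + eta%:E.
Proof.
move=> e0 eta0 a01 w0 wle.
have a0 k : 0 <= a k by have /andP[] := a01 k.
rewrite -nneseriesZl//.
apply: (@le_trans _ _
  (\sum_(k <oo) (e%:E * a k + (eta / (2 ^ k.+1)%:R)%:E))); last first.
  by apply: epsilon_trick => // k; rewrite mule_ge0.
apply: lee_nneseries => [k _ _|k _]; first by rewrite mule_ge0.
have /andP[_ ak] := a01 k.
apply: (@le_trans _ _ (a k * (e + eta / (2 ^ k.+1)%:R / k.+1%:R)%:E)).
  exact: lee_wpmul2l.
have d0 : (0 <= eta / (2 ^ k.+1)%:R / k.+1%:R)%R by rewrite !divr_ge0.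
rewrite EFinD ge0_muleDr ?lee_fin// leeD//; first by rewrite muleC.
apply: (@le_trans _ _ (k.+1%:R%:E * (eta / (2 ^ k.+1)%:R / k.+1%:R)%:E)).
  by rewrite lee_wpmul2r// lee_fin.
by rewrite -EFinM lee_fin mulrC divfK// pnatr_eq0.
Qed.

Section crossed_mixture_cost.
Context d1 d2 (T1 : measurableType d1) (T2 : measurableType d2) (R : realType).
Variables (g1 : nat -> probability T1 R) (g2 : nat -> probability T2 R).
Variables (A : nat -> set T1) (B : nat -> set T2).
Hypotheses (mA : forall k, measurable (A k)) (mB : forall l, measurable (B l)).
Hypotheses (tA : trivIset [set: nat] A) (tB : trivIset [set: nat] B).
Hypotheses (UA : \bigcup_k A k = [set: T1]) (UB : \bigcup_l B l = [set: T2]).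
Variables (f : T1 -> R) (h : T2 -> R) (e eta : R).
Hypotheses (mf : measurable_fun [set: T1] f) (mh : measurable_fun [set: T2] h).
Hypotheses (f0 : forall x, (0 <= f x)%R) (h0 : forall y, (0 <= h y)%R).
Hypotheses (e0 : (0 <= e)%R) (eta0 : (0 <= eta)%R).

Let mEf : measurable_fun [set: T1] (EFin \o f).
Proof. exact/measurable_EFinP. Qed.

Let mEh : measurable_fun [set: T2] (EFin \o h).
Proof. exact/measurable_EFinP. Qed.

Let Ef0 x : 0 <= (EFin \o f) x.
Proof. by rewrite lee_fin. Qed.

Let Eh0 x : 0 <= (EFin \o h) x.
Proof. by rewrite lee_fin. Qed.

(** The cost [f] of the first factor is multiplied by the weight [h] of the
    second; since the cell [B l], on which the weight is at most l + 1, selects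
    the measure [g1 l], the excess cost can be chosen small against the weight. *)
Lemma crossed_mixture_cost_left (b : nat -> \bar R) :
  (forall k l, \int[g2 k]_(y in B l) (h y)%:E = b l) ->
  (forall l, 0 <= b l <= l.+1%:R%:E) ->
  (forall l, \int[g1 l]_x (f x)%:E <=
    (e + eta / (2 ^ l.+1)%:R / l.+1%:R)%:E) ->
  \int[crossed_mixture g1 g2 mA mB]_z (f z.1 * h z.2)%:E
    <= e%:E * \sum_(l <oo) b l + eta%:E.
Proof.
move=> hb b_le fe.
apply: (le_trans _ (series_near_optimal_le e0 eta0 b_le _ fe)); last first.
  by move=> l; apply: integral_ge0 => x _; exact: Ef0.
have := integral_crossed_mixture_left g1 mA mB tA UA mEf mEh Ef0 Eh0 hb.
under eq_integral do rewrite /= -EFinM.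
by move=> ->; under eq_eseriesr do rewrite muleC.
Qed.

Lemma crossed_mixture_cost_right (a : nat -> \bar R) :
  (forall k l, \int[g1 l]_(x in A k) (f x)%:E = a k) ->
  (forall k, 0 <= a k <= k.+1%:R%:E) ->
  (forall k, \int[g2 k]_y (h y)%:E <=
    (e + eta / (2 ^ k.+1)%:R / k.+1%:R)%:E) ->
  \int[crossed_mixture g1 g2 mA mB]_z (f z.1 * h z.2)%:E
    <= e%:E * \sum_(k <oo) a k + eta%:E.
Proof.
move=> fa a_le he.
apply: (le_trans _ (series_near_optimal_le e0 eta0 a_le _ he)); last first.
  by move=> k; apply: integral_ge0 => x _; exact: Eh0.
have := integral_crossed_mixture_right g2 mA mB tB UB mEf mEh Ef0 Eh0 fa.
by under eq_integral do rewrite /= -EFinM; move=> ->.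
Qed.

End crossed_mixture_cost.

Section crossed_mixture_marginals.
Context d1 d2 (T1 : measurableType d1) (T2 : measurableType d2) (R : realType).
Variables (g1 : nat -> probability T1 R) (g2 : nat -> probability T2 R).
Context d3 d4 (X1 : measurableType d3) (X2 : measurableType d4).
Variables (f1 : T1 -> X1) (f2 : T2 -> X2).
Hypotheses (mf1 : measurable_fun [set: T1] f1) (mf2 : measurable_fun [set: T2] f2).
Variables (m1 : probability X1 R) (m2 : probability X2 R).
Hypothesis g1m : forall k S, measurable S -> g1 k (f1 @^-1` S) = m1 S.
Hypothesis g2m : forall k S, measurable S -> g2 k (f2 @^-1` S) = m2 S.
Variables (A : nat -> set T1) (B : nat -> set T2).
Hypotheses (mA : forall k, measurable (A k)) (mB : forall l, measurable (B l)).
Hypotheses (tA : trivIset [set: nat] A) (tB : trivIset [set: nat] B).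
Hypotheses (UA : \bigcup_k A k = [set: T1]) (UB : \bigcup_l B l = [set: T2]).

Let f12 (z : T1 * T2) := (f1 z.1, f2 z.2).

Let mf12 : measurable_fun [set: T1 * T2] f12.
Proof. by apply: measurable_fun_pair; apply: measurableT_comp. Qed.

Let crossed_mixture_rectangle U V : measurable U -> measurable V ->
  crossed_mixture g1 g2 mA mB (f12 @^-1` (U `*` V)) =
  \int[crossed_mixture g1 g2 mA mB]_z
    ((\1_(f1 @^-1` U) z.1)%:E * (\1_(f2 @^-1` V) z.2)%:E).
Proof.
move=> mU mV; rewrite -[X in crossed_mixture _ _ _ _ X]setIT -integral_indic//.
- apply: eq_integral => z _; rewrite -EFinM !indicE; congr (_%:E).
  rewrite (_ : z \in _ = (z.1 \in f1 @^-1` U) && (z.2 \in f2 @^-1` V)).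
    by case: (_ \in _); case: (_ \in _); rewrite ?mulr1 ?mulr0.
  by apply/idP/andP; rewrite !inE.
- by rewrite -[X in measurable X]setTI; apply: mf12 => //; exact: measurableX.
Qed.

(** The variables [f1] and [f2] are independent under the mixture as soon as [f2]
    alone determines the cell of the second factor: then the second factor
    selects by [f2], whose law is [m2] under each [g2 k], and [f1] has law [m1]
    under each of the measures thus selected. *)
Lemma crossed_mixture_marginal_left (B' : nat -> set X2) :
  (forall l, measurable (B' l)) -> (forall l, B l = f2 @^-1` B' l) ->
  forall S, measurable S ->
  crossed_mixture g1 g2 mA mB (f12 @^-1` S) = (m1 \x m2) S.
Proof.
move=> mB' BE S mS; apply/esym.
pose m' : {measure set (X1 * X2) -> \bar R} :=
  pushforward (crossed_mixture g1 g2 mA mB) f12.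
suff m'E U V : measurable U -> measurable V -> m' mf12 (U `*` V) = m1 U * m2 V.
  exact: (product_measure_unique m'E mS).
move=> mU mV.
have mU1 : measurable (f1 @^-1` U) by rewrite -[X in measurable X]setTI; exact: mf1.
have mV2 : measurable (f2 @^-1` V) by rewrite -[X in measurable X]setTI; exact: mf2.
rewrite [LHS]crossed_mixture_rectangle//.
rewrite (integral_crossed_mixture_left _ _ _ tA UA
  (f := fun x => (\1_(f1 @^-1` U) x)%:E)
  (h := fun y => (\1_(f2 @^-1` V) y)%:E)
  (b := fun l => m2 (V `&` B' l)))//; first last.
- by move=> k l; rewrite integral_indic// BE; exact: g2m (measurableI _ _ mV (mB' l)).
- exact/measurable_EFinP.
- exact/measurable_EFinP.
have g1U l : \int[g1 l]_x (\1_(f1 @^-1` U) x)%:E = m1 U.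
  by rewrite integral_indic// setIT; exact: g1m.
have g2V : \int[g2 0]_y (\1_(f2 @^-1` V) y)%:E = m2 V.
  by rewrite integral_indic// setIT; exact: g2m.
under eq_eseriesr do rewrite g1U.
rewrite -[m1 U]fineK ?fin_num_measure// nneseriesZl//; congr (_ * _).
rewrite -g2V -(ge0_integral_partition _ mB tB UB)//; last exact/measurable_EFinP.
apply: eq_eseriesr => l _.
by rewrite integral_indic// BE; apply/esym; exact: g2m (measurableI _ _ mV (mB' l)).
Qed.

Lemma crossed_mixture_marginal_right (A' : nat -> set X1) :
  (forall k, measurable (A' k)) -> (forall k, A k = f1 @^-1` A' k) ->
  forall S, measurable S ->
  crossed_mixture g1 g2 mA mB (f12 @^-1` S) = (m1 \x m2) S.
Proof.
move=> mA' AE S mS; apply/esym.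
pose m' : {measure set (X1 * X2) -> \bar R} :=
  pushforward (crossed_mixture g1 g2 mA mB) f12.
suff m'E U V : measurable U -> measurable V -> m' mf12 (U `*` V) = m1 U * m2 V.
  exact: (product_measure_unique m'E mS).
move=> mU mV.
have mU1 : measurable (f1 @^-1` U) by rewrite -[X in measurable X]setTI; exact: mf1.
have mV2 : measurable (f2 @^-1` V) by rewrite -[X in measurable X]setTI; exact: mf2.
rewrite [LHS]crossed_mixture_rectangle//.
rewrite (integral_crossed_mixture_right _ _ _ tB UB
  (f := fun x => (\1_(f1 @^-1` U) x)%:E)
  (h := fun y => (\1_(f2 @^-1` V) y)%:E)
  (a := fun k => m1 (U `&` A' k)))//; first last.
- by move=> k l; rewrite integral_indic// AE; exact: g1m (measurableI _ _ mU (mA' k)).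
- exact/measurable_EFinP.
- exact/measurable_EFinP.
have g1U : \int[g1 0]_x (\1_(f1 @^-1` U) x)%:E = m1 U.
  by rewrite integral_indic// setIT; exact: g1m.
have g2V k : \int[g2 k]_y (\1_(f2 @^-1` V) y)%:E = m2 V.
  by rewrite integral_indic// setIT; exact: g2m.
under eq_eseriesr do rewrite g2V muleC.
rewrite muleC -[m2 V]fineK ?fin_num_measure// nneseriesZl//; congr (_ * _).
rewrite -g1U -(ge0_integral_partition _ mA tA UA)//; last exact/measurable_EFinP.
apply: eq_eseriesr => k _.
by rewrite integral_indic// AE; apply/esym; exact: g1m (measurableI _ _ mU (mA' k)).
Qed.

End crossed_mixture_marginals.

(** * Level sets of the cost *)

Section cost_levels.
Context {R : realType} {n : nat} (c : 'rV[R]_n -> R).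
Hypotheses (c_ge0 : forall x, (0 <= c x)%R)
  (mc : measurable_fun [set: borel_rV R n] c).

Definition cost_level (k : nat) : set (borel_rV R n) :=
  [set x | (k%:R <= c x < k.+1%:R)%R].

Lemma measurable_cost_level k : measurable (cost_level k).
Proof.
rewrite -[X in measurable X]setTI (_ : cost_level k = c @^-1` `[k%:R, k.+1%:R[).
  by apply: mc => //; exact: measurable_itv.
by apply/seteqP; split=> x /=; rewrite in_itv.
Qed.

Lemma trivIset_cost_level : trivIset [set: nat] cost_level.
Proof.
move=> j k _ _ [x [xj xk]].
by rewrite -(truncn_def xj) -(truncn_def xk).
Qed.

Lemma bigcup_cost_level : \bigcup_k cost_level k = [set: borel_rV R n].
Proof.
apply/seteqP; split=> // x _; exists (Num.trunc (c x)) => //.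
exact: truncn_itv.
Qed.

Lemma integral_cost_level (P : probability (borel_rV R n) R) k :
  0 <= \int[P]_(x in cost_level k) (c x)%:E <= k.+1%:R%:E.
Proof.
rewrite integral_ge0/=; last by move=> x _; rewrite lee_fin.
apply: (@le_trans _ _ (\int[P]_(x in cost_level k) (k.+1%:R%:E))).
  apply: ge0_le_integral.
  - exact: measurable_cost_level.
  - by move=> x _; rewrite lee_fin.
  - by apply/measurable_EFinP; exact: measurable_funTS.
  - exact: measurable_cst.
  - by move=> x /= /andP[_ /ltW]; rewrite lee_fin.
rewrite integral_cst; last exact: measurable_cost_level.
rewrite -[leRHS]mule1 lee_pmul//.
by apply: probability_le1; exact: measurable_cost_level.
Qed.

End cost_levels.

(** * Transport balls and Hadamard products *)

Section hadamard_balls.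
Context {R : realType} {n : nat} (c : 'rV[R]_n -> R) (p : R).
Hypotheses (c_ge0 : forall x, (0 <= c x)%R)
  (mc : measurable_fun [set: borel_rV R n] c)
  (c_hadamard : forall x1 x2 x3 : 'rV[R]_n,
       (c (hadamard x1 x3 - hadamard x2 x3) <= c (x1 - x2) * c x3)%R)
  (p_ge1 : (1 <= p)%R)
  (c_triangle : forall x1 x2 x3 : 'rV[R]_n,
       (c (x1 - x3) `^ p^-1 <= c (x1 - x2) `^ p^-1 + c (x2 - x3) `^ p^-1)%R).

Local Notation X := (borel_rV R n).
Local Notation displacement_cost :=
  (fun z : X * X => c ((z.1 : 'rV[R]_n) - (z.2 : 'rV[R]_n))%R).

Lemma measurable_displacement_cost :
  measurable_fun [set: X * X] displacement_cost.
Proof. exact: measurableT_comp mc (measurable_sub_rV (R := R) (n := n)). Qed.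

Let mdc := measurable_displacement_cost.

Lemma near_optimal_coupling (P P' : probability X R) (e d : R) :
  transport_ball c e%:E P P' -> (0 < d)%R ->
  exists2 g, coupling P P' g & \int[g]_z (displacement_cost z)%:E <= (e + d)%:E.
Proof.
move=> PP' d0.
have /ereal_inf_lt[_ [g gPP' <-] /ltW ?] : transport_cost c P P' < (e + d)%:E.
  by rewrite (le_lt_trans PP')// lte_fin ltrDl.
by exists g.
Qed.

(** The triangle inequality for c^(1/p) between x', x and 0, integrated against a
    nearly optimal coupling of (x', x). *)
Lemma root_moment_ball (P P' : probability X R) (e : R) :
  (0 <= e)%R -> transport_ball c e%:E P P' ->
  (\int[P']_x (c x)%:E) `^ p^-1 <=
  e%:E `^ p^-1 + (\int[P]_x (c x)%:E) `^ p^-1.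
Proof.
move=> e0 PP'; apply/lee_addgt0Pr => h h0.
have [g gPP' gle] := near_optimal_coupling PP' (powR_gt0 p h0).
have mc1 := measurableT_comp mc (@measurable_fst _ _ X X).
have mc2 := measurableT_comp mc (@measurable_snd _ _ X X).
have ec0 x : 0 <= (c x)%:E by rewrite lee_fin.
have mec : measurable_fun [set: X] (EFin \o c) by exact/measurable_EFinP.
have <- : \int[g]_z (c z.1)%:E = \int[P']_x (c x)%:E.
  rewrite -[RHS](@ge0_integral_marginal _ _ _ _ _ g _ _ _ _ measurable_fst)//.
  by move=> S mS; have [] := gPP' S mS.
have <- : \int[g]_z (c z.2)%:E = \int[P]_x (c x)%:E.
  rewrite -[RHS](@ge0_integral_marginal _ _ _ _ _ g _ _ _ _ measurable_snd)//.
  by move=> S mS; have [] := gPP' S mS.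
apply: (le_trans (le_root_integral_add (u := fun z : X * X => c z.1)
  (v := displacement_cost) (w := fun z : X * X => c z.2)
  g p_ge1 mc1 mdc mc2 _ _ _ _)) => //.
  by move=> z; have := c_triangle z.1 z.2 0%R; rewrite !subr0.
rewrite addeAC leeD2r//; apply: root_le_add => //.
- by apply: integral_ge0 => z _; rewrite lee_fin.
- exact: ltW.
Qed.

(** The intermediate point is x' y.  It makes the weights c y and c x', which are
    functions of the two variables y and x' that are independent in the mixture
    and select the couplings. *)
Lemma root_cost_hadamard (x' x y' y : 'rV[R]_n) :
  (c (hadamard x' y' - hadamard x y) `^ p^-1 <=
   (c (x' - x) * c y) `^ p^-1 + (c x' * c (y' - y)) `^ p^-1)%R.
Proof.
have hadamardC (u v : 'rV[R]_n) : hadamard u v = hadamard v u.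
  by apply/matrixP => i j; rewrite !mxE mulrC.
have e0 : (0 <= p^-1)%R by rewrite invr_ge0 (le_trans _ p_ge1).
apply: (le_trans (c_triangle _ (hadamard x' y) _)); rewrite addrC lerD//.
  by rewrite ge0_ler_powR ?nnegrE ?mulr_ge0.
rewrite ge0_ler_powR ?nnegrE ?mulr_ge0// mulrC.
by rewrite (hadamardC x' y') (hadamardC x' y).
Qed.

(** The coupling is the law of (x' y', x y) under the crossed mixture of nearly
    optimal couplings.  The error eta is added to the products e1 E_Q[c] and
    e2 E_P'[c] rather than to e1 and e2, so that it vanishes in the limit even if
    a moment is infinite. *)
Lemma hadamard_coupling (P Q P' Q' : probability X R) (e1 e2 eta : R) :
  (0 <= e1)%R -> (0 <= e2)%R -> (0 < eta)%R ->
  transport_ball c e1%:E P P' -> transport_ball c e2%:E Q Q' ->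
  exists2 g, coupling (hadamard_prob P Q) (hadamard_prob P' Q') g &
    (\int[g]_z (displacement_cost z)%:E) `^ p^-1 <=
    (e1%:E * \int[Q]_x (c x)%:E + eta%:E) `^ p^-1 +
    (e2%:E * \int[P']_x (c x)%:E + eta%:E) `^ p^-1.
Proof.
move=> e10 e20 eta0 PP' QQ'.
have d0 k : (0 < eta / (2 ^ k.+1)%:R / k.+1%:R :> R)%R.
  by rewrite !divr_gt0// ltr0n expn_gt0.
have /choice[g1 g1P] k : exists g, coupling P P' g /\
    \int[g]_z (displacement_cost z)%:E <= (e1 + eta / (2 ^ k.+1)%:R / k.+1%:R)%:E.
  by have [g] := near_optimal_coupling PP' (d0 k); exists g.
have /choice[g2 g2P] k : exists g, coupling Q Q' g /\
    \int[g]_z (displacement_cost z)%:E <= (e2 + eta / (2 ^ k.+1)%:R / k.+1%:R)%:E.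
  by have [g] := near_optimal_coupling QQ' (d0 k); exists g.
(* Couplings list the new variable first: x' is [z.1.1], x is [z.1.2], y' is
   [z.2.1] and y is [z.2.2].  The cells of the first factor are those of x', the
   cells of the second one those of y. *)
pose A k : set (X * X) := fst @^-1` cost_level c k.
pose B l : set (X * X) := snd @^-1` cost_level c l.
have mA k : measurable (A k).
  rewrite -[X in measurable X]setTI; apply: measurable_fst => //.
  exact: measurable_cost_level.
have mB l : measurable (B l).
  rewrite -[X in measurable X]setTI; apply: measurable_snd => //.
  exact: measurable_cost_level.
have tA : trivIset [set: nat] A
  by move=> j k _ _ [z zjk]; apply: (@trivIset_cost_level R n c) => //; eexists; exact: zjk.
have tB : trivIset [set: nat] B
  by move=> j k _ _ [z zjk]; apply: (@trivIset_cost_level R n c) => //; eexists; exact: zjk.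
have UA : \bigcup_k A k = [set: X * X] by rewrite -preimage_bigcup bigcup_cost_level.
have UB : \bigcup_k B k = [set: X * X] by rewrite -preimage_bigcup bigcup_cost_level.
pose gamma := crossed_mixture g1 g2 mA mB.
have gamma2 S : measurable S ->
    gamma ((fun z => (z.1.2, z.2.2)) @^-1` S) = (P \x Q) S.
  apply: (crossed_mixture_marginal_left (f1 := snd) (f2 := snd)
    measurable_snd measurable_snd _ _ mA mB tA tB UA UB
    (fun l => measurable_cost_level mc l) (fun=> erefl)).
  - by move=> k U mU; have [/(_ U mU)[]] := g1P k.
  - by move=> k U mU; have [/(_ U mU)[]] := g2P k.
have gamma1 S : measurable S ->
    gamma ((fun z => (z.1.1, z.2.1)) @^-1` S) = (P' \x Q') S.
  apply: (crossed_mixture_marginal_right (f1 := fst) (f2 := fst)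
    measurable_fst measurable_fst _ _ mA mB tA tB UA UB
    (fun l => measurable_cost_level mc l) (fun=> erefl)).
  - by move=> k U mU; have [/(_ U mU)[]] := g1P k.
  - by move=> k U mU; have [/(_ U mU)[]] := g2P k.
pose phi (z : (X * X) * (X * X)) : X * X :=
  (hadamard_pair (z.1.1, z.2.1), hadamard_pair (z.1.2, z.2.2)).
have mphi : measurable_fun [set: (X * X) * (X * X)] phi.
  apply: measurable_fun_pair.
    apply: (measurableT_comp measurable_hadamard_pair).
    by apply: measurable_fun_pair; apply: measurableT_comp.
  apply: (measurableT_comp measurable_hadamard_pair).
  by apply: measurable_fun_pair; apply: measurableT_comp.
have mhad (S : set X) : measurable S ->
    measurable (@hadamard_pair R n @^-1` S).
  by move=> mS; rewrite -[X in measurable X]setTI; exact: measurable_hadamard_pair.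
have gammaT : gamma [set: (X * X) * (X * X)] = 1.
  exact: (etrans (gamma2 setT measurableT) (probability_setT (P \x Q))).
have [g gE] : exists g : probability (X * X)%type R,
    forall S, gamma (phi @^-1` S) = g S.
  have [G GE] := probability_of_mass_one gammaT.
  pose phiM : {mfun ((X * X) * (X * X))%type >-> (X * X)%type} :=
    HB.pack phi (isMeasurableFun.Build _ _ _ _ phi mphi).
  by exists (distribution G phiM) => S; rewrite -GE.
exists g.
  move=> S mS; split; rewrite -gE.
    exact: gamma2 (mhad S mS).
  exact: gamma1 (mhad S mS).
have mc1 := measurableT_comp mc (@measurable_fst _ _ X X).
have mc2 := measurableT_comp mc (@measurable_snd _ _ X X).
have <- : \int[gamma]_z (displacement_cost (phi z))%:E =
          \int[g]_z (displacement_cost z)%:E.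
  rewrite -[RHS](@ge0_integral_marginal _ _ _ _ _ gamma _ _ _ _ mphi)//.
  - by move=> S _; exact: gE.
  - exact/measurable_EFinP.
  - by move=> z; rewrite lee_fin.
pose v (z : (X * X) * (X * X)) := (displacement_cost z.1 * c z.2.2)%R.
pose w (z : (X * X) * (X * X)) := (c z.1.1 * displacement_cost z.2)%R.
have mv : measurable_fun [set: (X * X) * (X * X)] v.
  by apply: measurable_funM; [exact: measurableT_comp mdc _|exact: measurableT_comp mc2 _].
have mw : measurable_fun [set: (X * X) * (X * X)] w.
  by apply: measurable_funM; [exact: measurableT_comp mc1 _|exact: measurableT_comp mdc _].
apply: (le_trans (le_root_integral_add (v := v) (w := w) gamma p_ge1 _ mv mw _ _ _ _)) => //.
- exact: measurableT_comp mdc mphi.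
- by move=> z; rewrite mulr_ge0.
- by move=> z; rewrite mulr_ge0.
- by move=> z; exact: root_cost_hadamard.
have e0 : (0 <= p^-1)%R by rewrite invr_ge0 (le_trans _ p_ge1).
have ec0 x : 0 <= (EFin \o c) x by rewrite lee_fin.
have mec : measurable_fun [set: X] (EFin \o c) by exact/measurable_EFinP.
have sum_levels (m : probability X R) :
    \int[m]_x (c x)%:E = \sum_(k <oo) \int[m]_(x in cost_level c k) (c x)%:E.
  apply/esym/(ge0_integral_partition m _ _ _ mec ec0).
  - exact: measurable_cost_level.
  - exact: trivIset_cost_level.
  - exact: bigcup_cost_level.
have root_mono (x y : \bar R) : 0 <= x -> x <= y -> x `^ p^-1 <= y `^ p^-1.
  move=> x0 xy; apply: gt0_ler_poweR => //; rewrite in_itv/= leey andbT//.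
  exact: le_trans xy.
apply: leeD; apply: root_mono.
- by apply: integral_ge0 => z _; rewrite lee_fin mulr_ge0.
- rewrite (sum_levels Q).
  apply: (crossed_mixture_cost_left mA mB tA UA mdc mc2
    (fun=> c_ge0 _) (fun=> c_ge0 _) e10 (ltW eta0)).
  + move=> k l.
    apply: (@ge0_integral_marginal _ _ _ _ _ (g2 k) _ _ _ _ measurable_snd _ _ mec) => //.
    * by move=> S mS; have [/(_ S mS)[]] := g2P k.
    * exact: measurable_cost_level.
  + exact: integral_cost_level.
  + by move=> k; have [] := g1P k.
- by apply: integral_ge0 => z _; rewrite lee_fin mulr_ge0.
- rewrite (sum_levels P').
  apply: (crossed_mixture_cost_right mA mB tB UB mc1 mdc
    (fun=> c_ge0 _) (fun=> c_ge0 _) e20 (ltW eta0)).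
  + move=> k l.
    apply: (@ge0_integral_marginal _ _ _ _ _ (g1 l) _ _ _ _ measurable_fst _ _ mec) => //.
    * by move=> S mS; have [/(_ S mS)[]] := g1P l.
    * exact: measurable_cost_level.
  + exact: integral_cost_level.
  + by move=> k; have [] := g2P k.
Qed.

(** The bound on the coupling is e1^(1/p) E_Q[c]^(1/p) + e2^(1/p) E_P'[c]^(1/p) in
    the limit, and the cross term e1^(1/p) e2^(1/p) comes from comparing the moment
    of P' with that of P. *)
Lemma hadamard_transport_ball (P Q P' Q' : probability X R) (e1 e2 : R) :
  (0 <= e1)%R -> (0 <= e2)%R ->
  transport_ball c e1%:E P P' -> transport_ball c e2%:E Q Q' ->
  transport_ball c
    ((e1%:E `^ p^-1 * e2%:E `^ p^-1
      + e1%:E `^ p^-1 * (\int[Q]_x (c x)%:E) `^ p^-1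
      + e2%:E `^ p^-1 * (\int[P]_x (c x)%:E) `^ p^-1) `^ p)
    (hadamard_prob P Q) (hadamard_prob P' Q').
Proof.
move=> e10 e20 PP' QQ'; rewrite /transport_ball/=.
set rho := (X in X `^ p); set W := transport_cost c _ _.
have p0 : (0 < p)%R by rewrite (lt_le_trans _ p_ge1).
have int_ge0 d (T : measurableType d) (m : {measure set T -> \bar R}) (f : T -> R) :
    (forall x, (0 <= f x)%R) -> 0 <= \int[m]_x (f x)%:E.
  by move=> f0; apply: integral_ge0 => x _; rewrite lee_fin.
have in0y (x : \bar R) : 0 <= x -> x \in `[0, +oo].
  by move=> x0; rewrite in_itv/= x0 leey.
have W0 : 0 <= W.
  by apply: le_ereal_inf_tmp => _ [g _ <-]; apply: int_ge0.
suff Wrho : W `^ p^-1 <= rho.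
  rewrite -[W]poweRe1// -(mulVf (lt0r_neq0 p0)) poweRrM.
  apply: gt0_ler_poweR => //; [exact: ltW|exact/in0y/poweR_ge0|].
  exact/in0y/(le_trans (poweR_ge0 _ _) Wrho).
apply/lee_addgt0Pr => h h0.
have h20 : (0 < h / 2)%R by rewrite divr_gt0.
(* Each of the two roots contributes an error h / 2. *)
have [g gPQ gle] := hadamard_coupling e10 e20 (powR_gt0 p h20) PP' QQ'.
apply: (@le_trans _ _ ((\int[g]_z (displacement_cost z)%:E) `^ p^-1)).
  apply: gt0_ler_poweR; rewrite ?invr_ge0 ?(ltW p0)//.
  - exact: in0y.
  - exact/in0y/int_ge0.
  - by apply: ereal_inf_lbound; exists g.
apply: (le_trans gle).
have rle (x : \bar R) : 0 <= x ->
    (x + ((h / 2) `^ p)%:E) `^ p^-1 <= x `^ p^-1 + (h / 2)%:E.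
  move=> x0; apply: root_le_add => //; last exact: ltW.
  by rewrite adde_ge0// lee_fin powR_ge0.
have Q0 := int_ge0 _ _ Q c c_ge0; have P0 := int_ge0 _ _ P c c_ge0.
have P'0 := int_ge0 _ _ P' c c_ge0.
apply: (le_trans (leeD (rle _ _) (rle _ _))); rewrite ?mule_ge0//.
rewrite addeACA -EFinD -splitr leeD2r// !poweRM//.
rewrite /rho [X in _ <= X + _]addeC -addeA leeD2l//.
apply: (@le_trans _ _ (e2%:E `^ p^-1 *
    (e1%:E `^ p^-1 + (\int[P]_x (c x)%:E) `^ p^-1))).
  by apply: lee_wpmul2l; [exact: poweR_ge0|exact: root_moment_ball].
by rewrite ge0_muleDr ?poweR_ge0// [X in X + _]muleC.
Qed.

End hadamard_balls.

Local Close Scope ereal_scope.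

Theorem theorem16 (R : realType) (n : nat)
    (P Q : probability (borel_rV R n) R) (eps1 eps2 : R)
    (c : 'rV[R]_n -> R) (p : R)
    (eps1_ge0 : 0 <= eps1) (eps2_ge0 : 0 <= eps2)
    (c_ge0 : forall x, 0 <= c x)
    (c_lsc : lower_semicontinuous (fun x => (c x)%:E))
    (c_hadamard : forall x1 x2 x3 : 'rV[R]_n,
       c (hadamard x1 x3 - hadamard x2 x3) <= c (x1 - x2) * c x3)
    (p_ge1 : 1 <= p)
    (c_triangle : forall x1 x2 x3 : 'rV[R]_n,
       c (x1 - x3) `^ p^-1 <= c (x1 - x2) `^ p^-1 + c (x2 - x3) `^ p^-1) :
  hadamard_set (transport_ball c eps1%:E P) (transport_ball c eps2%:E Q)
  `<=`
  transport_ball c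
    ((eps1%:E `^ p^-1 * eps2%:E `^ p^-1
      + eps1%:E `^ p^-1 * (\int[Q]_x (c x)%:E) `^ p^-1
      + eps2%:E `^ p^-1 * (\int[P]_x (c x)%:E) `^ p^-1) `^ p)%E
    (hadamard_prob P Q).
Proof.
move=> _ [P' PP' [Q' QQ' <-]].
exact: (hadamard_transport_ball c_ge0 (measurable_lsc c_lsc)).
Qed.
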